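(* Let $\varphi\colon\mathbb{R}^n\to\overline{\mathbb{R}}$ be a lower semicontinuous function, and fix $\bar x\in\mathbb{R}^n$ such that $|\varphi(\bar x)|<\infty$. Then the following assertions hold. (a) Pick $u\in\mathcal{C}_\varphi(\bar x)\cap\mathbb{S}$. If $\bar x$ is a local minimizer of $\varphi$ in direction $u$, then $0\in\partial^{\mathrm{p}}\varphi(\bar x;u)$. (b) If $\bar x$ is a local minimizer of $\varphi$, then $0\in\partial^{\mathrm{p}}\varphi(\bar x)$, and $0\in\partial^{\mathrm{p}}\varphi(\bar x;u)$ is valid for each $u\in\mathcal{C}_\varphi(\bar x)\cap\mathbb{S}$.
   Context: $\overline{\mathbb{R}}:=\mathbb{R}\cup\{-\infty,\infty\}$; $\mathbb{R}^n$ carries the Euclidean norm $\|\cdot\|$ and inner product $\langle\cdot,\cdot\rangle$; $\mathbb{S}:=\{u\in\mathbb{R}^n : \|u\|=1\}$; $\mathbb{B}_\varepsilon(\bar x)$ is the closed ball of radius $\varepsilon$ around $\bar x$. Directional neighborhoods: for $\varepsilon,\rho>0$ and $u\in\mathbb{R}^n$, $\mathbb{B}_{\varepsilon,\rho}(u):=\{w\in\mathbb{R}^n : \|w\|\le\varepsilon,\ \big\|\|w\|u-\|u\|w\big\|\le\rho\|u\|\|w\|\}$. Directional local minimality: $\bar x$ (with $|\varphi(\bar x)|<\infty$) is a local minimizer of $\varphi$ in direction $u$ if there are $\varepsilon,\rho>0$ with $\varphi(x)\ge\varphi(\bar x)$ for all $x\in\bar x+\mathbb{B}_{\varepsilon,\rho}(u)$.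 A local minimizer is meant in the usual sense (equivalently, $u=0$). First subderivative: $\mathrm{d}\varphi(\bar x)(u):=\liminf_{t\downarrow0,\,u'\to u}\frac{\varphi(\bar x+tu')-\varphi(\bar x)}{t}$. Critical cone: $\mathcal{C}_\varphi(\bar x):=\{u\in\mathbb{R}^n : \mathrm{d}\varphi(\bar x)(u)\le0\}$. Proximal subdifferential: $\partial^{\mathrm{p}}\varphi(\bar x)$ is the set of $x^*\in\mathbb{R}^n$ for which there are $\varepsilon,\gamma>0$ with $\varphi(x)\ge\varphi(\bar x)+\langle x^*,x-\bar x\rangle-\gamma\|x-\bar x\|^2$ for all $x\in\mathbb{B}_\varepsilon(\bar x)$. Directional proximal subdifferential: for $u\in\mathbb{R}^n$ with $|\mathrm{d}\varphi(\bar x)(u)|<\infty$, the directional proximal pre-subdifferential $\widetilde\partial^{\mathrm{p}}\varphi(\bar x;u)$ is the set of $x^*\in\mathbb{R}^n$ for which there are $\varepsilon,\rho,\gamma>0$ with $\varphi(x)\ge\varphi(\bar x)+\langle x^*,x-\bar x\rangle-\gamma\|x-\bar x\|^2$ for all $x\in\bar x+\mathbb{B}_{\varepsilon,\rho}(u)$, and $\partial^{\mathrm{p}}\varphi(\bar x;u):=\widetilde\partial^{\mathrm{p}}\varphi(\bar x;u)\cap\{x^*\in\mathbb{R}^n : \mathrm{d}\varphi(\bar x)(u)=\langle x^*,u\rangle\}$. *)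

(* Defs.v *)
From HB Require Import structures.
From mathcomp Require Import all_boot all_order all_algebra.
From mathcomp Require Import all_classical all_reals all_analysis.

Set Implicit Arguments.
Unset Strict Implicit.
Unset Printing Implicit Defensive.

Import Order.TTheory GRing.Theory Num.Theory.
Import numFieldNormedType.Exports.

Local Open Scope classical_set_scope.
Local Open Scope ring_scope.

(* The library's norm on 'rV[R]_n is the sup norm, hence a separate Euclidean
   norm; both induce the library topology of 'rV[R]_n, which is the one used
   for lower semicontinuity and for the limit u' -> u below. *)
Definition dotp (R : realType) (n : nat) (u v : 'rV[R]_n) : R :=
  \sum_(i < n) u 0 i * v 0 i.

Definition enorm (R : realType) (n : nat) (u : 'rV[R]_n) : R :=
  Num.sqrt (dotp u u).

Definition esphere (R : realType) (n : nat) : set 'rV[R]_n :=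
  [set u | enorm u = 1].

Definition ecball (R : realType) (n : nat) (x : 'rV[R]_n) (e : R) :
  set 'rV[R]_n := [set y | enorm (y - x) <= e].

Definition dir_nbhd (R : realType) (n : nat) (e r : R) (u : 'rV[R]_n) :
  set 'rV[R]_n :=
  [set w | enorm w <= e /\
           enorm (enorm w *: u - enorm u *: w) <= r * enorm u * enorm w].

Definition local_minimizer (R : realType) (n : nat)
    (phi : 'rV[R]_n -> \bar R) (xb : 'rV[R]_n) : Prop :=
  phi xb \is a fin_num /\
  exists2 e : R, 0 < e &
    forall x, ecball xb e x -> (phi xb <= phi x)%E.

Definition dir_local_minimizer (R : realType) (n : nat)
    (phi : 'rV[R]_n -> \bar R) (xb u : 'rV[R]_n) : Prop :=
  phi xb \is a fin_num /\
  exists e r : R, [/\ 0 < e, 0 < r &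
    forall x, dir_nbhd e r u (x - xb) -> (phi xb <= phi x)%E].

Definition subderivative (R : realType) (n : nat)
    (phi : 'rV[R]_n -> \bar R) (xb u : 'rV[R]_n) : \bar R :=
  limf_einf
    (fun p : R * 'rV[R]_n =>
       ((phi (xb + p.1 *: p.2)%R - phi xb) * (p.1^-1)%:E)%E)
    (filter_prod (0 : R)^'+ (nbhs u)).

Definition critical_cone (R : realType) (n : nat)
    (phi : 'rV[R]_n -> \bar R) (xb : 'rV[R]_n) : set 'rV[R]_n :=
  [set u | (subderivative phi xb u <= 0)%E].

Definition prox_subdiff (R : realType) (n : nat)
    (phi : 'rV[R]_n -> \bar R) (xb : 'rV[R]_n) : set 'rV[R]_n :=
  [set xs | exists e g : R, [/\ 0 < e, 0 < g &
    forall x, ecball xb e x ->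
      (phi xb + (dotp xs (x - xb) - g * enorm (x - xb) ^+ 2)%:E <= phi x)%E]].

(* Only meaningful when the subderivative at u is finite; by convention the
   set is empty otherwise, so membership entails that it is well defined. *)
Definition dir_prox_presubdiff (R : realType) (n : nat)
    (phi : 'rV[R]_n -> \bar R) (xb u : 'rV[R]_n) : set 'rV[R]_n :=
  [set xs | subderivative phi xb u \is a fin_num /\
    exists e r g : R, [/\ 0 < e, 0 < r, 0 < g &
      forall x, dir_nbhd e r u (x - xb) ->
        (phi xb + (dotp xs (x - xb) - g * enorm (x - xb) ^+ 2)%:E
           <= phi x)%E]].

Definition dir_prox_subdiff (R : realType) (n : nat)
    (phi : 'rV[R]_n -> \bar R) (xb u : 'rV[R]_n) : set 'rV[R]_n :=
  dir_prox_presubdiff phi xb u `&`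
  [set xs | subderivative phi xb u = (dotp xs u)%:E].

(* Main.v *)
Require Import Defs.
From mathcomp Require Import all_boot all_order all_algebra.
From mathcomp Require Import all_classical all_reals all_analysis.

Import Order.TTheory GRing.Theory Num.Theory.
Import numFieldNormedType.Exports.

Local Open Scope classical_set_scope.
Local Open Scope ring_scope.

(** A minimality inequality [phi xb <= phi x] is already the proximal inequality
for the subgradient [0], with any positive constant: the quadratic term only
lowers the minorant. What needs an argument is that the subderivative at a
critical direction [u] is finite and equal to [<0, u> = 0]. It is nonpositive
because [u] is critical. It is nonnegative because the points [xb + t *: u']
sampled by the lower limit [t -> 0+, u' -> u] end up in every directional
neighborhood of [xb] around [u] ([near_dir_nbhd]), so directional minimality
makes all the difference quotients nonnegative near the limit
([subderivative_ge0]). A local minimizer is a minimizer in every direction,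
which reduces the second assertion to the first. *)

Lemma dot0p (R : realType) (n : nat) (v : 'rV[R]_n) : dotp 0 v = 0.
Proof. by rewrite /dotp big1 // => i _; rewrite mxE mul0r. Qed.

Lemma enorm0 (R : realType) (n : nat) : enorm (0 : 'rV[R]_n) = 0.
Proof. by rewrite /enorm dot0p sqrtr0. Qed.

Lemma enormZ (R : realType) (n : nat) (t : R) (v : 'rV[R]_n) :
  0 <= t -> enorm (t *: v) = t * enorm v.
Proof.
move=> t0; rewrite /enorm.
have -> : dotp (t *: v) (t *: v) = t ^+ 2 * dotp v v.
  rewrite /dotp mulr_sumr; apply: eq_bigr => i _.
  by rewrite !mxE mulrACA expr2.
by rewrite sqrtrM ?sqr_ge0// sqrtr_sqr ger0_norm.
Qed.

(** Continuity is meant for the product topology of row vectors; this is how the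
Euclidean norm of the directional neighborhoods and the topology of the limit
[u' -> u] are brought together. *)
Lemma enorm_continuous (R : realType) (n : nat) :
  continuous (@enorm R n).
Proof.
move=> v; apply: (@continuous_comp _ _ _ (fun w => dotp w w) Num.sqrt).
  apply: (@continuous_big R _ +%R 0 xpredT (@add_continuous R^o) 'rV[R]_n _
     (fun i w => w 0 i * w 0 i)) => i _ w.
  by apply: (@cvgM _ _ _ (nbhs_filter w)); exact: coord_continuous.
exact: sqrt_continuous.
Qed.

(** The angular condition defining [dir_nbhd] is homogeneous in the point, so it
does not see the step [t]; at [u' = u] it holds strictly, hence it persists
near [u] by continuity. The radial condition only asks [t] to be small. *)
Lemma near_dir_nbhd (R : realType) (n : nat) (e r : R) (u : 'rV[R]_n) :
  0 < e -> 0 < r -> 0 < enorm u ->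
  \forall t \near (0 : R)^'+ & u' \near u, dir_nbhd e r u (t *: u').
Proof.
move=> e0 r0 u0.
have norm_cvg : enorm u' @[u' --> u] --> enorm u by exact: enorm_continuous.
(* [gap u' >= 0] is the angular condition on [t *: u'], divided by [t]. *)
pose gap (u' : 'rV[R]_n) := r * enorm u * enorm u'
  - enorm (enorm u' *: u - enorm u *: u').
have gap_cvg : gap u' @[u' --> u] --> gap u.
  apply: (@cvgB _ _ _ _ (nbhs_filter u)).
    by apply: (@cvgM _ _ _ (nbhs_filter u)) => //; exact: cvg_cst.
  apply: (@continuous_cvg _ _ _ _ _ (fun u' => enorm u' *: u - enorm u *: u')
    (@enorm R n)); first exact: enorm_continuous.
  apply: (@cvgB _ _ _ _ (nbhs_filter u)).
    exact: (@cvgZr_tmp _ _ _ _ (nbhs_filter u)).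
  by apply: (@cvgZl_tmp _ _ _ _ (nbhs_filter u)); exact: cvg_id.
have gap_gt0 : 0 < gap u by rewrite /gap subrr enorm0 subr0 !mulr_gt0.
(* Bounding [enorm u'] turns the radial condition into a bound on [t]. *)
have near_u : \forall u' \near u, enorm u' < enorm u + 1 /\ 0 < gap u'.
  near=> u'; split; near: u'.
  - by apply: (cvgr_lt _ norm_cvg); rewrite ltrDl.
  - exact: (cvgr_gt _ gap_cvg).
have near_0 : \forall t \near (0 : R)^'+, 0 < t /\ t < e / (enorm u + 1).
  near=> t; split; near: t; first exact: nbhs_right_gt.
  by apply: nbhs_right_lt; rewrite divr_gt0// addr_gt0.
apply: (filter_pair_set _ _ _ (conj near_0 near_u)).
move=> t u' [t0 te] [u'u gap_pos].
rewrite /dir_nbhd /= (enormZ _ _ t u' (ltW t0)); split.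
  apply: (@le_trans _ _ (t * (enorm u + 1))).
    by rewrite ler_pM2l// ltW.
  by rewrite -ler_pdivlMr ?ltW// addr_gt0.
rewrite scalerA [enorm u * t]mulrC -!scalerA -scalerBr.
by rewrite (enormZ _ _ t _ (ltW t0)) mulrCA ler_pM2l// -subr_ge0 ltW.
Unshelve. all: by end_near. Qed.

Lemma limf_einf_ge (T : choiceType) (X : filteredType T) (R : realType)
    (f : X -> \bar R) (F : set_system X) (a : \bar R) :
  (\forall x \near F, (a <= f x)%E) -> (a <= limf_einf f F)%E.
Proof.
move=> Fa; rewrite limf_einfE.
apply: (@le_trans _ _ (ereal_inf (f @` [set x | (a <= f x)%E]))).
  by apply: le_ereal_inf_tmp => _ [x afx <-].
by apply: (@ereal_sup_ubound R); exists [set x | (a <= f x)%E].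
Qed.

(** The sampled points eventually lie in the directional neighborhood where
[phi xb] is minimal; there the numerators of the difference quotients are
well-defined and nonnegative because [phi xb] is finite. *)
Lemma subderivative_ge0 (R : realType) (n : nat) (phi : 'rV[R]_n -> \bar R)
    (xb u : 'rV[R]_n) :
  0 < enorm u -> dir_local_minimizer phi xb u ->
  (0 <= subderivative phi xb u)%E.
Proof.
move=> u0 [phi_fin [e [r [e0 r0 phi_min]]]]; apply: limf_einf_ge.
have near_gt0 : \forall t \near (0 : R)^'+ & _ \near u, 0 < t.
  exact: (@filter_prod1 _ _ _ _ (nbhs_filter u) _ (nbhs_right_gt 0)).
apply: filterS2 near_gt0 (near_dir_nbhd R n e r u e0 r0 u0).
move=> -[t u'] /= t0 dir_u'.
apply: mule_ge0; last by rewrite lee_fin invr_ge0 ltW.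
by rewrite sube_ge0 ?phi_fin//; apply: phi_min; rewrite addrAC subrr add0r.
Qed.

Lemma zero_prox_minorant (R : realType) (n : nat) (a b : \bar R)
    (w : 'rV[R]_n) :
  (a <= b)%E -> (a + (dotp 0 w - 1 * enorm w ^+ 2)%:E <= b)%E.
Proof.
apply: le_trans; rewrite -[leRHS]adde0 leeD2l// lee_fin.
by rewrite dot0p mul1r sub0r oppr_le0 sqr_ge0.
Qed.

Lemma zero_dir_prox_subdiff (R : realType) (n : nat)
    (phi : 'rV[R]_n -> \bar R) (xb u : 'rV[R]_n) :
  0 < enorm u -> critical_cone phi xb u -> dir_local_minimizer phi xb u ->
  dir_prox_subdiff phi xb u 0.
Proof.
move=> u0 u_crit u_min.
have d0 : subderivative phi xb u = 0%E.
  by apply/eqP; rewrite eq_le u_crit subderivative_ge0.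
case: u_min => _ [e [r [e0 r0 phi_min]]].
split; last by rewrite /= d0 dot0p.
split; first by rewrite d0.
exists e, r, 1; split=> // x x_dir.
exact/zero_prox_minorant/phi_min.
Qed.

(** Discarding the angular condition of [dir_nbhd] leaves a ball. *)
Lemma local_minimizer_dir (R : realType) (n : nat)
    (phi : 'rV[R]_n -> \bar R) (xb u : 'rV[R]_n) :
  local_minimizer phi xb -> dir_local_minimizer phi xb u.
Proof.
move=> [phi_fin [e e0 phi_min]]; split=> //.
by exists e, 1; split=> // x [x_e _]; exact: phi_min.
Qed.

Theorem theorem4p10 (R : realType) (n : nat) (phi : 'rV[R]_n -> \bar R)
    (xb : 'rV[R]_n)
    (lsc_phi : lower_semicontinuous phi)
    (phi_xb_fin : phi xb \is a fin_num) :
  (forall u : 'rV[R]_n, (critical_cone phi xb `&` @esphere R n) u ->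
     dir_local_minimizer phi xb u ->
     dir_prox_subdiff phi xb u 0) /\
  (local_minimizer phi xb ->
     prox_subdiff phi xb 0 /\
     forall u : 'rV[R]_n, (critical_cone phi xb `&` @esphere R n) u ->
       dir_prox_subdiff phi xb u 0).
Proof.
have dir u : (critical_cone phi xb `&` @esphere R n) u ->
    dir_local_minimizer phi xb u -> dir_prox_subdiff phi xb u 0.
  move=> [u_crit u1]; apply: zero_dir_prox_subdiff => //.
  by rewrite u1.
split=> // xb_min; split; last first.
  by move=> u u_crit; apply: dir => //; exact: local_minimizer_dir.
case: xb_min => _ [e e0 phi_min].
exists e, 1; split=> // x x_e.
exact/zero_prox_minorant/phi_min.
Qed.
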